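(* Let $\mathbb L$ be the Bregman Lagrangian $$\mathbb L(X_t,\dot X_t,t)=e^{\alpha_t+\gamma_t}\Big(V_h\big(X_t+e^{-\alpha_t}\dot X_t,\,X_t\big)-e^{\beta_t}\Phi(X_t)\Big),$$ where $X_t\in\hat K$, $\dot X_t\in\mathbb R^n$ and $t\in\mathbb T$ represent position, velocity and time. Under the ideal scaling conditions $\dot\beta_t\le e^{\alpha_t}$ and $\dot\gamma_t=e^{\alpha_t}$, the Euler–Lagrange equation $$\frac{d}{dt}\frac{\partial\mathbb L}{\partial\dot X_t}(X_t,\dot X_t,t)-\frac{\partial\mathbb L}{\partial X_t}(X_t,\dot X_t,t)=0$$ associated with $\mathbb L$ reduces to the continuous-time dynamical system $$d\,\nabla h\big(X_t+e^{-\alpha_t}\dot X_t\big)=-e^{\alpha_t+\beta_t}\,\nabla\Phi(X_t)\,dt.$$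
   Context: $\mathcal X\subseteq\mathbb R^n$ is convex and compact, $I=\{1,\dots,m\}$, $f:\mathcal X\to\mathbb R$ is $m_f$-strongly convex ($m_f>0$), and $g_i:\mathcal X\to\mathbb R$ ($i\in I$) are convex. For a barrier parameter $c>0$ and a slack $s\ge0$, $\Phi(x)=f(x)-\frac1c\sum_{i\in I}\log(s-g_i(x))$ on $\hat K=\{x\in\mathcal X:g_i(x)<s\ \forall i\in I\}$; $\Phi$ is twice differentiable and strongly convex. The function $h$ is a distance-generating function with modulus $\mu>0$, i.e. continuously differentiable and $\mu$-strongly convex on $\mathbb R^n$, and $V_h(x,y)=h(x)-h(y)-\langle\nabla h(y),x-y\rangle$ is its Bregman divergence. $\mathbb T\subseteq\mathbb R_+$ is the set of times, $\alpha,\beta,\gamma:\mathbb T\to\mathbb R$ are smooth increasing functions, $t\mapsto X_t$ is a curve and $\dot X_t=dX_t/dt$. The partial derivatives of $\mathbb L$ are with respect to its position and velocity arguments. *)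

(* Defs.v *)
From HB Require Import structures.
From mathcomp Require Import all_boot all_order all_algebra.
From mathcomp Require Import all_classical all_reals all_analysis.

Set Implicit Arguments.
Unset Strict Implicit.
Unset Printing Implicit Defensive.

Import Order.TTheory GRing.Theory Num.Theory.
Import numFieldNormedType.Exports.

Local Open Scope classical_set_scope.
Local Open Scope ring_scope.

Section EuclideanSpace.
Context {R : realType} {n : nat}.
Implicit Types (x y u v : 'rV[R]_n) (f : 'rV[R]_n -> R).

(* The norm `|x| of the library on 'rV[R]_n is the sup norm; the Euclidean
   structure is given by dot, and dot u u is the squared Euclidean norm. *)
Definition dot u v : R := \sum_(i < n) u 0 i * v 0 i.

(* 'D_v is total, so this is the gradient only where f is differentiable. *)
Definition grad f x : 'rV[R]_n := \row_(i < n) 'D_(delta_mx 0 i) f x.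

Definition twice_differentiable_at f x :=
  (\forall y \near x, differentiable f y) /\ differentiable (grad f) x.

Definition strongly_convex (D : set 'rV[R]_n) (m : R) f :=
  forall (x y : 'rV[R]_n) (t : R), D x -> D y -> 0 <= t -> t <= 1 ->
    f (t *: x + (1 - t) *: y) <=
      t * f x + (1 - t) * f y - m / 2 * (t * (1 - t)) * dot (x - y) (x - y).

Definition distance_generating (mu : R) (h : 'rV[R]_n -> R) :=
  [/\ forall x, differentiable h x,
      continuous (grad h) &
      strongly_convex setT mu h].

Definition bregman (h : 'rV[R]_n -> R) x y : R :=
  h x - h y - dot (grad h y) (x - y).

End EuclideanSpace.

(* Differentiation with respect to a time ranging over a set T: the difference
   quotients at t only involve times in T, so that the derivative is one-sided
   at an end point of T. The limit is unique if t is a limit point of T. *)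
Section TimeDerivative.
Context {R : realType} {V : normedModType R}.
Implicit Types (T : set R) (F : R -> V) (t : R).

Definition time_derivable T F t :=
  cvg ((s - t)^-1 *: (F s - F t) @[s --> within T t^']).

Definition ddt T F t : V :=
  lim ((s - t)^-1 *: (F s - F t) @[s --> within T t^']).

Definition smooth_on T F :=
  forall k t, T t -> time_derivable T (iter k (ddt T) F) t.

End TimeDerivative.

Section Barrier.
Context {R : realType} {n m : nat}.

Definition Khat (calX : set 'rV[R]_n) (g : 'I_m -> 'rV[R]_n -> R) (s : R) :
    set 'rV[R]_n :=
  [set x | calX x /\ forall i, g i x < s].

Definition barrier (f : 'rV[R]_n -> R) (g : 'I_m -> 'rV[R]_n -> R) (c s : R)
    (x : 'rV[R]_n) : R :=
  f x - c^-1 * \sum_(i < m) ln (s - g i x).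

End Barrier.

Section Lagrangian.
Context {R : realType} {n : nat}.
Implicit Types (L : 'rV[R]_n -> 'rV[R]_n -> R -> R) (X : R -> 'rV[R]_n).
Implicit Types (T : set R) (t : R).

Definition bregman_lagrangian (h Phi : 'rV[R]_n -> R)
    (alpha beta gamma : R -> R) (x v : 'rV[R]_n) t : R :=
  expR (alpha t + gamma t) *
    (bregman h (x + expR (- alpha t) *: v) x - expR (beta t) * Phi x).

Definition dL_dposition L x v t : 'rV[R]_n := grad (fun y => L y v t) x.

Definition dL_dvelocity L x v t : 'rV[R]_n := grad (fun w => L x w t) v.

Definition euler_lagrange T L X t :=
  let p s := dL_dvelocity L (X s) (ddt T X s) s in
  time_derivable T p t /\ ddt T p t - dL_dposition L (X t) (ddt T X t) t = 0.

(* d grad h (X_t + e^{- alpha_t} X'_t)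
     = - e^{alpha_t + beta_t} grad Phi (X_t) dt *)
Definition mirror_dynamics T (h Phi : 'rV[R]_n -> R) (alpha beta : R -> R)
    X t :=
  let z s := grad h (X s + expR (- alpha s) *: ddt T X s) in
  time_derivable T z t /\
  ddt T z t = - (expR (alpha t + beta t) *: grad Phi (X t)).

End Lagrangian.

(* Main.v *)
Require Import Defs.
From HB Require Import structures.
From mathcomp Require Import all_boot all_order all_algebra.
From mathcomp Require Import all_classical all_reals all_analysis.
From mathcomp Require Import ring lra.

(* Write z = x + e^{-alpha} v. The momentum is
     dL/dv = e^gamma (grad h(z) - grad h(x)),
   and along a curve with x' = v the term d/dt (grad h(X_t)) = D(grad h)(X_t) v
   cancels the contribution of grad h(y) to dL/dx, because the Hessian of h is
   symmetric. Since gamma' = e^alpha, the terms in grad h(z) - grad h(x) cancel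
   too, and what remains of the Euler-Lagrange expression is
     e^gamma (d/dt grad h(z) + e^{alpha + beta} grad Phi(x)).
   The Hessian exists at the points of the curve because L is differentiable in
   the position there for every velocity, and its symmetry needs no more than
   differentiability of grad h at the point. *)

Set Implicit Arguments.
Unset Strict Implicit.
Unset Printing Implicit Defensive.

Import Order.TTheory GRing.Theory Num.Theory.
Import numFieldNormedType.Exports.

Local Open Scope classical_set_scope.
Local Open Scope ring_scope.

(** * Symmetry of second directional derivatives at a point *)

Section SecondDerivative.
Context {R : realType} {V : normedModType R}.

Lemma near_differential_le {W : normedModType R} (f : V -> W) (x : V) (e : R) :
  differentiable f x -> 0 < e ->
  \forall y \near x, `|f y - f x - 'd f x (y - x)| <= e * `|y - x|.
Proof.
move=> /diff_locally dfx e0; rewrite (near_shift 0) subr0.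
move/eqaddoP : dfx => /(_ _ e0); apply: filterS => y /=.
by rewrite !fctE /= addrK opprD addrA.
Qed.

(** [A] carries the line through [a] along [e] to the line through [A a] along [e'] with the same
    parameter, so the two difference quotients are equal and derivability of [h] in the single
    direction [e'] suffices. *)
Lemma is_derive_comp_affine {U W : normedModType R} (A : U -> V) (h : V -> W)
    (a e : U) (e' : V) :
  (forall r : R, A (r *: e + a) = r *: e' + A a) -> derivable h (A a) e' ->
  is_derive a e (h \o A) ('D_e' h (A a)).
Proof.
move=> Ae dh.
have eq : (fun r : R => r^-1 *: (((h \o A) \o shift a) (r *: e) - (h \o A) a)) =
          (fun r => r^-1 *: ((h \o shift (A a)) (r *: e') - h (A a))).
  by apply/funext => r /=; rewrite Ae.
by split; [rewrite /derivable eq|rewrite /derive eq].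
Qed.

Lemma is_derive_along_line (h : V -> R) (y v : V) (r : R) :
  differentiable h (y + r *: v) ->
  is_derive r 1 (fun r => h (y + r *: v)) ('D_v h (y + r *: v)).
Proof.
move=> dh; apply: (@is_derive_comp_affine R^o _ (fun r => y + r *: v)).
  by move=> k; rewrite -[k *: 1]/(k * 1) mulr1 scalerDl addrCA.
exact: diff_derivable.
Qed.

(* By the mean value theorem, the second difference of h at x along t u and t v
   is t (D_v h (x + t u + r v) - D_v h (x + r v)) for some r between 0 and t. *)
Lemma second_difference_near (h : V -> R) (x u v : V) (e : R) :
  (\forall y \near x, differentiable h y) -> differentiable ('D_v h) x -> 0 < e ->
  \forall t \near (0:R)^'+,
   `|h (x + t *: u + t *: v) - h (x + t *: u) - h (x + t *: v) + h x
     - t ^+ 2 * 'D_u ('D_v h) x| <= e * t ^+ 2.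
Proof.
move=> hd dB e0; set B := 'D_v h; rewrite (deriveE _ dB).
(* [t * M] bounds every increment from [x] inside the parallelogram spanned by [t *: u] and
   [t *: v]; the summand 1 keeps [M] positive. *)
pose M := `|u| + `|v| + 1.
have M0 : 0 < M by rewrite /M ltr_wpDl// addr_ge0.
(* With this constant, the first-order remainder of [B] at an increment of norm at most [t * M] is
   at most [e / 2 * t]; two such remainders will occur. *)
have e2 : 0 < e / (2 * M) by rewrite divr_gt0// mulr_gt0.
have : nbhs x [set y | differentiable h y /\
    `|B y - B x - 'd B x (y - x)| <= e / (2 * M) * `|y - x| ].
  exact: filterI hd (near_differential_le dB e2).
move=> /nbhs_ballP[d /= d0 dP].
near=> t.
have t0 : 0 < t by near: t; exact: nbhs_right_gt.
have tM : t * M < d.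
  by rewrite -ltr_pdivlMr//; near: t; apply: nbhs_right_lt; rewrite divr_gt0.
(* Only [k = 0] and [k = 1] are used: the two sides of the parallelogram parallel to [v]. *)
have inb k w : 0 <= k <= 1 -> 0 <= w <= t ->
    `|k *: (t *: u) + w *: v| <= t * M /\ ball x d (x + k *: (t *: u) + w *: v).
  move=> /andP[k0 k1] /andP[w0 wt].
  have le : `|k *: (t *: u) + w *: v| <= t * M.
    rewrite (le_trans (ler_normD _ _))// !normrZ (gtr0_norm t0) !ger0_norm//.
    apply: (@le_trans _ _ (t * `|u| + t * `|v|)).
      by rewrite lerD ?ler_wpM2r// ler_piMl// mulr_ge0// ltW.
    by rewrite -mulrDr ler_wpM2l ?(ltW t0)// /M lerDl.
  split=> //.
  rewrite -ball_normE/= -addrA opprD addrA subrr add0r normrN.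
  exact: le_lt_trans tM.
have in0 w : 0 <= w <= t -> ball x d (x + w *: v).
  by move=> /(inb 0)[|_]; rewrite ?lexx ?ler01// scale0r addr0.
have in1 w : 0 <= w <= t -> ball x d (x + t *: u + w *: v).
  by move=> /(inb 1)[|_]; rewrite ?lexx ?ler01// scale1r.
pose phi (r : R) := h (x + t *: u + r *: v) - h (x + r *: v).
have dphi r : 0 <= r <= t ->
    is_derive r 1 phi (B (x + t *: u + r *: v) - B (x + r *: v)).
  move=> rt; apply: is_deriveB.
  - by apply: is_derive_along_line; have [] := dP _ (in1 _ rt).
  - by apply: is_derive_along_line; have [] := dP _ (in0 _ rt).
have [|||r] := @MVT R phi (fun r => B (x + t *: u + r *: v) - B (x + r *: v)) 0 t.
- by [].
- by move=> r; rewrite in_itv/= => /andP[/ltW r0 /ltW rt]; apply: dphi; rewrite r0.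
- apply: derivable_within_continuous => r; rewrite in_itv/= => rt.
  by have [] := dphi _ rt.
rewrite in_itv/= subr0 => /andP[/ltW r0 /ltW rt].
rewrite /phi !scale0r !addr0 => phiE.
have rt' : 0 <= r <= t by rewrite r0.
have [_] := dP _ (in0 _ rt').
have [_] := dP _ (in1 _ rt').
have [|l0 _] := inb 0 r _ rt'; first by rewrite lexx ler01.
have [|l1 _] := inb 1 r _ rt'; first by rewrite lexx ler01.
rewrite scale0r add0r in l0; rewrite scale1r in l1.
have -> : x + t *: u + r *: v - x = t *: u + r *: v.
  by rewrite -[x + _ + _]addrA (addrC x) addrK.
have -> : x + r *: v - x = r *: v by rewrite addrAC subrr add0r.
move=> /le_trans/(_ (ler_wpM2l (ltW e2) l1)) b1.
move=> /le_trans/(_ (ler_wpM2l (ltW e2) l0)) b0.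
move: b0 b1; have -> : e / (2 * M) * (t * M) = e / 2 * t by field; rewrite gt_eqF.
pose du := 'd B x u; pose dv := 'd B x v.
have -> : 'd B x (r *: v) = r * dv by rewrite linearZ.
have -> : 'd B x (t *: u + r *: v) = t * du + r * dv by rewrite linearD !linearZ.
rewrite -/du => b0 b1.
set B1 := B (x + _ + _) in phiE b1; set B0 := B (x + _) in phiE b0.
(* The error is [t] times the difference of the remainders of [B] at the two points given by the
   mean value theorem: the terms [r * dv] cancel, and [t * du] is left. *)
rewrite [X in `|X|](_ : _ =
  t * ((B1 - B x - (t * du + r * dv)) - (B0 - B x - r * dv))).
  rewrite normrM (gtr0_norm t0) expr2 mulrCA (ler_wpM2l (ltW t0))//.
  apply: le_trans (ler_normB _ _) _. apply: le_trans (lerD b1 b0) _; lra.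
rewrite [RHS](_ : _ = (B1 - B0) * t - t ^+ 2 * du); last by ring.
by rewrite -phiE opprB; ring.
Unshelve. all: by end_near. Qed.

(** The second difference is symmetric in [u] and [v], and for small [t] both mixed derivatives
    multiplied by [t ^+ 2] lie within [e / 2 * t ^+ 2] of it. *)
Lemma derive_derive_comm (h : V -> R) (x u v : V) :
  (\forall y \near x, differentiable h y) ->
  differentiable ('D_u h) x -> differentiable ('D_v h) x ->
  'D_u ('D_v h) x = 'D_v ('D_u h) x.
Proof.
move=> hd du dv; apply/eqP; rewrite -subr_eq0 -normr_le0.
apply/ler_addgt0Pl => e e0; rewrite addr0.
have e2 : 0 < e / 2 by rewrite divr_gt0.
have uvP := second_difference_near u hd dv e2.
have vuP := second_difference_near v hd du e2.
have [t [[uv vu] t0]] := filter_ex (filterI (filterI uvP vuP) (nbhs_right_gt 0)).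
have t20 : 0 < t ^+ 2 by rewrite exprn_gt0.
rewrite -(ler_pM2l t20) -[X in X * `|_|](gtr0_norm t20) -normrM mulrBr.
set D := h (x + t *: u + t *: v) - h (x + t *: u) - h (x + t *: v) + h x.
rewrite (le_trans (ler_distD D _ _))// (splitr e) (mulrC _ (_ + _)) mulrDl.
apply: lerD; first by rewrite distrC; exact: uv.
rewrite /D (addrAC x) (addrAC (h _)); exact: vu.
Qed.

End SecondDerivative.

(** * Calculus of derivatives in a time restricted to a set *)

Section TimeDerivativeCalculus.
Context {R : realType} (T : set R) (t : R).
Context (Tt : limit_point T t).
Implicit Types V W : normedModType R.

(** Relational form of [ddt]: existence and value are carried together, so the rules below compose
    without separate derivability conditions. *)
Definition has_ddt {V} (F : R -> V) (l : V) :=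
  (s - t)^-1 *: (F s - F t) @[s --> within T t^'] --> l.

(** This is where [t] being a limit point of [T] enters; properness makes limits along the filter
    unique, so that [ddt] is the limit. *)
#[local] Instance within_dnbhs_proper : ProperFilter (within T t^').
Proof.
apply: Build_ProperFilter_ex => P; rewrite /within/= => tP.
by have [s [st Ts /(_ st Ts) Ps]] := Tt tP; exists s.
Qed.

Lemma has_ddtP {V} (F : R -> V) (l : V) :
  has_ddt F l <-> time_derivable T F t /\ ddt T F t = l.
Proof.
split=> [Fl|[dF <-]]; last exact: dF.
by split; [exact: cvgP Fl|exact: cvg_lim Fl].
Qed.

(** For [s != t], [F s] is [F t] plus [s - t] times the difference quotient, and the quotient
    converges. *)
Lemma has_ddt_cvg {V} (F : R -> V) (l : V) :
  has_ddt F l -> F s @[s --> within T t^'] --> F t.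
Proof.
move=> Fl; rewrite -[X in _ --> X]addr0 -(scale0r l) -(subrr t).
have nst : \forall s \near within T t^', s != t.
  by rewrite near_withinE; apply: filterS (nbhs_dnbhs_neq t) => s.
have sct : s @[s --> within T t^'] --> t.
  by move=> P tP; rewrite /= /within/=; apply: filterS (nbhs_dnbhs tP) => s.
apply: (@cvg_trans _ ((F t + (s - t) *: ((s - t)^-1 *: (F s - F t)))
    @[s --> within T t^'])).
  apply: near_eq_cvg; near=> s; have st : s - t != 0 by rewrite subr_eq0; near: s.
  by rewrite scalerA divff// scale1r subrKC.
apply: cvgD; first exact: cvg_cst.
by apply: cvgZ => //; apply: cvgB => //; exact: cvg_cst.
Unshelve. all: by end_near. Qed.

(** The quotient of [G \o F] is the differential of [G] applied to the quotient [q] of [F], plus a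
    scaled remainder. The first part converges by continuity of the differential, the second
    vanishes because [q] stays bounded. *)
Lemma has_ddt_comp {V W} (F : R -> V) (G : V -> W) (l : V) :
  has_ddt F l -> differentiable G (F t) -> has_ddt (G \o F) ('d G (F t) l).
Proof.
move=> Fl dG.
pose q s := (s - t)^-1 *: (F s - F t).
rewrite /has_ddt -[X in _ --> X]addr0.
apply: (@cvg_trans _ (('d G (F t) (q s) + (s - t)^-1 *: (G (F s) - G (F t)
   - 'd G (F t) (F s - F t))) @[s --> within T t^'])).
  by apply: near_eq_cvg; near=> s; rewrite /q linearZ/= -scalerDr subrKC.
apply: cvgD.
  by apply: continuous_cvg Fl; exact: diff_continuous dG _.
apply/cvgr0Pnorm_le => e e0.
pose M := `|l| + 1.
have M0 : 0 < M by rewrite ltr_wpDl.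
have := has_ddt_cvg Fl (near_differential_le dG (divr_gt0 e0 M0)).
rewrite /= /nbhs/= => ne.
have qM : \forall s \near within T t^', `|q s| <= M.
  by have := cvgr_norm_le _ Fl; apply; rewrite ltrDl.
near=> s.
have sq : `|(s - t)^-1| * `|F s - F t| <= M by rewrite -normrZ; near: s.
rewrite normrZ.
apply: (@le_trans _ _ (`|(s - t)^-1| * (e / M * `|F s - F t|))).
  by rewrite ler_wpM2l//; near: s.
rewrite mulrCA (le_trans (ler_wpM2l _ sq)) ?divr_ge0 ?(ltW e0) ?(ltW M0)//.
by rewrite divfK ?gt_eqF.
Unshelve. all: by end_near. Qed.

Lemma has_ddt_cst {V} (a : V) : has_ddt (fun=> a) 0.
Proof.
by rewrite /has_ddt; under eq_fun do rewrite subrr scaler0; exact: cvg_cst.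
Qed.

Lemma has_ddtD {V} (F G : R -> V) (k l : V) :
  has_ddt F k -> has_ddt G l -> has_ddt (fun s => F s + G s) (k + l).
Proof.
move=> Fk Gl; rewrite /has_ddt; under eq_fun do rewrite opprD addrACA scalerDr.
exact: cvgD Fk Gl.
Qed.

Lemma has_ddtB {V} (F G : R -> V) (k l : V) :
  has_ddt F k -> has_ddt G l -> has_ddt (fun s => F s - G s) (k - l).
Proof.
move=> Fk Gl; rewrite /has_ddt.
under eq_fun do rewrite opprD addrACA -opprD scalerBr.
exact: cvgB Fk Gl.
Qed.

Lemma has_ddtZ {V} (a : R -> R) (F : R -> V) (k : R) (l : V) :
  has_ddt (a : R -> R^o) k -> has_ddt F l ->
  has_ddt (fun s => a s *: F s) (k *: F t + a t *: l).
Proof.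
move=> ak Fl; have Fc := has_ddt_cvg Fl; rewrite /has_ddt.
(* The increment is split with [F] taken at [s] and [a] at [t]; the first term then uses the
   convergence of [F s] to [F t]. *)
rewrite (_ : (fun s => _) = (fun s => ((s - t)^-1 * (a s - a t)) *: F s +
    a t *: ((s - t)^-1 *: (F s - F t)))).
  by apply: cvgD; [exact: cvgZ ak Fc|apply: cvgZ Fl; exact: cvg_cst].
apply/funext => s; rewrite scalerA (mulrC (a t)) -!scalerA -scalerDr.
by congr (_ *: _); rewrite scalerBl scalerBr addrA subrK.
Qed.

Lemma has_ddt_expR (a : R -> R) (l : R) : has_ddt (a : R -> R^o) l ->
  has_ddt (expR \o a : R -> R^o) (expR (a t) * l).
Proof.
move=> al.
have dexp : differentiable (expR : R^o -> R^o) (a t) by exact/derivable1_diffP.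
have := has_ddt_comp al dexp.
rewrite deriv1E; last exact/derivable1_diffP.
by rewrite derive1E derive_val [_ *: _]mulrC.
Qed.

End TimeDerivativeCalculus.

(** * Gradients and derivatives of the inner product *)

Section Gradient.
Context {R : realType} {n : nat}.
Implicit Types (x v w : 'rV[R]_n) (h Phi : 'rV[R]_n -> R).

Lemma dotC x v : dot x v = dot v x.
Proof. by apply: eq_bigr => i _; rewrite mulrC. Qed.

Lemma dotZr (k : R) x v : dot x (k *: v) = k * dot x v.
Proof. by rewrite [RHS]mulr_sumr; apply: eq_bigr => i _; rewrite mxE mulrCA. Qed.

Lemma dot_delta x (i : 'I_n) : dot x (delta_mx 0 i) = x 0 i.
Proof.
rewrite /dot (bigD1 i)//= !mxE !eqxx mulr1 big1 ?addr0// => j ji.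
by rewrite mxE (negbTE ji) andbF mulr0.
Qed.

Lemma derive_dot_grad h x v : differentiable h x -> 'D_v h x = dot (grad h x) v.
Proof.
move=> dh; rewrite [v in LHS]row_sum_delta (deriveE _ dh) linear_sum.
by apply: eq_bigr => i _; rewrite linearZ/= mxE (deriveE _ dh) mulrC.
Qed.

Lemma is_derive_dot {V : normedModType R} (G : V -> 'rV[R]_n) (y e : V) w :
  derivable G y e -> is_derive y e (fun y => dot (G y) w) (dot ('D_e G y) w).
Proof.
move=> dG; have dGi i :
    is_derive y e (fun y => G y 0 i * w 0 i) (('D_e G y) 0 i * w 0 i).
  rewrite derive_mx// mxE mulrC.
  under eq_fun do rewrite mulrC.
  apply: is_deriveZ; apply: derivableP; exact: (derivable_mxP _ _ _).1.
have := is_derive_sum dGi.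
rewrite (_ : \sum_(i < n) _ = fun y => dot (G y) w)//.
by apply/funext => z; rewrite fct_sumE.
Qed.

Lemma differentiable_dot {V : normedModType R} (G : V -> 'rV[R]_n) (y : V) w :
  differentiable G y -> differentiable (fun y => dot (G y) w) y.
Proof.
move=> dG; rewrite (_ : (fun y => _) = \sum_(i < n) (w 0 i *: (fun y => G y 0 i))).
  apply: differentiable_sum => i; apply: differentiableZ.
  exact: (differentiable_comp dG (differentiable_coord _ _ _)).
by apply/funext => z; rewrite fct_sumE; apply: eq_bigr => i _; exact: mulrC.
Qed.

Lemma differentiable_rV {V : normedModType R} (G : V -> 'rV[R]_n) (y : V) :
  (forall i, differentiable (fun y => G y 0 i) y) -> differentiable G y.
Proof.
move=> dG; rewrite (_ : G = \sum_(i < n) (fun y => G y 0 i *: delta_mx 0 i)).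
  by apply: differentiable_sum => i; apply: differentiableZl.
by apply/funext => z; rewrite fct_sumE [LHS]row_sum_delta.
Qed.

(** Symmetry of the Hessian: the left side is the derivative along the i-th basis vector of
    ['D_v h], the right side the derivative along [v] of the i-th partial derivative of [h]. *)
Lemma derive_grad_comm h x v (i : 'I_n) :
  (forall y, differentiable h y) -> differentiable (grad h) x ->
  dot ('D_(delta_mx 0 i) (grad h) x) v = 'D_v (grad h) x 0 i.
Proof.
move=> dh dG; have DhE w : 'D_w h = fun y => dot (grad h y) w.
  by apply/funext => y; exact: derive_dot_grad.
have dD w : differentiable ('D_w h) x by rewrite DhE; exact: differentiable_dot.
have dGv w w' : 'D_w' ('D_w h) x = dot ('D_w' (grad h) x) w.
  have /@derive_val := is_derive_dot w (@diff_derivable _ _ _ _ _ w' dG).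
  by rewrite DhE; exact.
have hd : \forall y \near x, differentiable h y.
  by near=> y; exact: dh.
rewrite -dGv (derive_derive_comm hd (dD _) (dD _)).
by rewrite dGv dot_delta.
Unshelve. all: by end_near. Qed.

(** * Partial derivatives of the Bregman Lagrangian *)

Section BregmanLagrangian.
Context (h Phi : 'rV[R]_n -> R) (alpha beta gamma : R -> R) (t : R).
Context (dh : forall x, differentiable h x).
Local Notation L := (bregman_lagrangian h Phi alpha beta gamma).
Local Notation k := (expR (- alpha t)).

Lemma bregman_lagrangianE x v : L x v t = expR (alpha t + gamma t) *
  (h (x + k *: v) - h x - k * dot (grad h x) v - expR (beta t) * Phi x).
Proof. by rewrite /bregman_lagrangian /bregman (addrC x) addrK dotZr. Qed.

(** Both velocity terms contribute a factor [k], which turns the prefactor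
    [expR (alpha t + gamma t)] into [expR (gamma t)]. *)
Lemma dL_dvelocityE x v :
  dL_dvelocity L x v t = expR (gamma t) *: (grad h (x + k *: v) - grad h x).
Proof.
apply/rowP => i; rewrite !mxE.
under [in LHS]eq_fun do rewrite bregman_lagrangianE dotC.
set e := delta_mx _ _.
have d1 : is_derive v e (fun w => h (x + k *: w)) ('D_(k *: e) h (x + k *: v)).
  apply: (@is_derive_comp_affine _ _ _ _ (fun w => x + k *: w)).
    by move=> r; rewrite scalerDr !scalerA mulrC addrCA.
  exact: diff_derivable.
have d2 : is_derive v e (fun w => dot w (grad h x)) (dot e (grad h x)).
  by have := is_derive_dot (grad h x) (@derivable_id _ _ v e); rewrite derive_id.
have -> : 'D_e (fun w => expR (alpha t + gamma t) * (h (x + k *: w) - h x -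
     k * dot w (grad h x) - expR (beta t) * Phi x)) v =
   expR (alpha t + gamma t) *
     ('D_(k *: e) h (x + k *: v) - 0 - k * dot e (grad h x) - 0).
  by apply: derive_val.
rewrite !derive_dot_grad// dotZr !(dotC e) !dot_delta !subr0 -mulrBr mulrA.
by rewrite (addrC (alpha t)) expRD expRN mulfK ?gt_eqF ?expR_gt0.
Qed.

(** For [v] the i-th basis vector, the Lagrangian contains the i-th component of [grad h y] with the
    nonzero factor [k]. Solving for it leaves only functions differentiable in [y]. *)
Lemma differentiable_grad x : differentiable Phi x ->
  (forall v, differentiable (fun y => L y v t) x) -> differentiable (grad h) x.
Proof.
move=> dPhi dL; apply: differentiable_rV => i.
pose v : 'rV[R]_n := delta_mx 0 i.
rewrite (_ : (fun y => _) = k^-1 *: ((fun y => h (y + k *: v)) - h -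
   expR (beta t) *: Phi - (expR (alpha t + gamma t))^-1 *: (fun y => L y v t))).
  apply: differentiableZ; apply: differentiableB; last exact: differentiableZ.
  apply: differentiableB; last exact: differentiableZ.
  apply: differentiableB => //.
  apply: (@differentiable_comp _ _ _ _ (fun y => y + k *: v) h) => //.
apply/funext => y; rewrite !fctE bregman_lagrangianE dot_delta.
rewrite -[_ *: (_ - _)]/(_ * _) -[_ *: Phi y]/(_ * _) -[_ *: (_ * _)]/(_ * _).
by field; rewrite !gt_eqF ?expR_gt0.
Qed.

Lemma dL_dpositionE x v : differentiable Phi x -> differentiable (grad h) x ->
  dL_dposition L x v t = expR (alpha t + gamma t) *:
    (grad h (x + k *: v) - grad h x - k *: 'D_v (grad h) x
      - expR (beta t) *: grad Phi x).
Proof.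
move=> dPhi dG; apply/rowP => i; rewrite mxE.
under [in LHS]eq_fun do rewrite bregman_lagrangianE.
(* Differentiating [dot (grad h y) v] in [y] yields the Hessian in this transposed form. *)
rewrite !mxE -derive_grad_comm//.
set e := delta_mx _ _.
have d1 : is_derive x e (fun y => h (y + k *: v)) ('D_e h (x + k *: v)).
  apply: (@is_derive_comp_affine _ _ _ _ (fun w => w + k *: v)).
    by move=> r; rewrite addrA.
  exact: diff_derivable.
have d2 := is_derive_dot v (@diff_derivable _ _ _ _ _ e dG).
have d3 := derivableP (@diff_derivable _ _ _ _ _ e (dh x)).
have d4 := derivableP (@diff_derivable _ _ _ _ _ e dPhi).
by apply: derive_val.
Qed.

End BregmanLagrangian.

End Gradient.

(** * The equivalence along a curve *)

Unset Implicit Arguments.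

Theorem proposition3p1 (R : realType) (n m : nat)
  (calX : set 'rV[R]_n) (f : 'rV[R]_n -> R) (g : 'I_m -> 'rV[R]_n -> R)
  (m_f c s : R)
  (hXconvex : convex_set calX) (hXcompact : compact calX)
  (hm_f : 0 < m_f) (hf : strongly_convex calX m_f f)
  (hg : forall i, convex_function calX (g i))
  (hc : 0 < c) (hs : 0 <= s)
  (hPhi : forall x, Khat calX g s x ->
     twice_differentiable_at (barrier f g c s) x)
  (h : 'rV[R]_n -> R) (mu : R) (hmu : 0 < mu) (hh : distance_generating mu h)
  (T : set R) (hTnonneg : forall t, T t -> 0 <= t) (hTlimit : T `<=` limit_point T)
  (alpha beta gamma : R -> R)
  (halpha : smooth_on T (alpha : R -> R^o))
  (hbeta : smooth_on T (beta : R -> R^o))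
  (hgamma : smooth_on T (gamma : R -> R^o))
  (halpha_incr : forall t1 t2, T t1 -> T t2 -> t1 <= t2 -> alpha t1 <= alpha t2)
  (hbeta_incr : forall t1 t2, T t1 -> T t2 -> t1 <= t2 -> beta t1 <= beta t2)
  (hgamma_incr : forall t1 t2, T t1 -> T t2 -> t1 <= t2 -> gamma t1 <= gamma t2)
  (* dL/dX exists; this does not follow from h being merely C^1, because the
     position argument of L also enters through grad h *)
  (hL : forall t x v, T t -> Khat calX g s x ->
     differentiable (fun y => bregman_lagrangian h (barrier f g c s)
       alpha beta gamma y v t) x)
  (hscaling_beta : forall t, T t -> ddt T (beta : R -> R^o) t <= expR (alpha t))
  (hscaling_gamma : forall t, T t -> ddt T (gamma : R -> R^o) t = expR (alpha t))
  (X : R -> 'rV[R]_n)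
  (hXK : forall t, T t -> Khat calX g s (X t))
  (hXderivable : forall t, T t -> time_derivable T X t) :
  forall t, T t ->
    euler_lagrange T
      (bregman_lagrangian h (barrier f g c s) alpha beta gamma) X t <->
    mirror_dynamics T h (barrier f g c s) alpha beta X t.
Proof.
move=> t Tt; set Phi := barrier f g c s; have [dh _ _] := hh.
have Tlim := hTlimit _ Tt.
have dPhi : differentiable Phi (X t).
  by have [/nbhs_singleton] := hPhi _ (hXK _ Tt).
have dG : differentiable (grad h) (X t).
  apply: (differentiable_grad (alpha := alpha) (beta := beta) (gamma := gamma)
    (t := t) dh dPhi) => v.
  by apply: hL => //; exact: hXK.
have X' : has_ddt T t X (ddt T X t).
  by apply/(has_ddtP Tlim); split=> //; exact: hXderivable.
have G' : has_ddt T t (grad h \o X) ('D_(ddt T X t) (grad h) (X t)).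
  by rewrite (deriveE _ dG); exact: has_ddt_comp.
have gamma' : has_ddt T t (gamma : R -> R^o) (expR (alpha t)).
  by apply/(has_ddtP Tlim); split; [exact: (hgamma 0%N)|exact: hscaling_gamma].
have Eg' := has_ddt_expR gamma'.
(* Prepares the recovery of [z] from the momentum [p], which requires dividing by
   [expR (gamma r)]. *)
have ENg' : has_ddt T t (fun r => expR (- gamma r) : R^o)
    (expR (- gamma t) * - expR (alpha t)).
  apply: (@has_ddt_expR _ _ _ (fun r => - gamma r)).
  have := has_ddtB (has_ddt_cst T t (0 : R^o)) gamma'.
  rewrite sub0r; under eq_fun do rewrite sub0r.
  exact.
pose z r := grad h (X r + expR (- alpha r) *: ddt T X r).
pose p r := expR (gamma r) *: (z r - grad h (X r)).
pose L := bregman_lagrangian h Phi alpha beta gamma.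
have pE : (fun r => dL_dvelocity L (X r) (ddt T X r) r) = p.
  by apply/funext => r; exact: dL_dvelocityE.
have p' l : has_ddt T t z l -> has_ddt T t p
   ((expR (gamma t) * expR (alpha t)) *: (z t - grad h (X t)) +
    expR (gamma t) *: (l - 'D_(ddt T X t) (grad h) (X t))).
  move=> zl; exact: (has_ddtZ Eg' (has_ddtB zl G')).
(* The Euler-Lagrange equation only asserts that [p] is derivable in time; derivability of [z]
   follows by inverting the formula for [p]. The value [l] may stay unspecified, since [ELE]
   determines it. *)
have z' q : has_ddt T t p q -> exists l, has_ddt T t z l.
  move=> pq; eexists.
  rewrite (_ : z = fun r => grad h (X r) + expR (- gamma r) *: p r).
    apply: has_ddtD => //; first exact: G'.
    exact: (has_ddtZ ENg' pq).
  apply/funext => r; rewrite /p scalerA -expRD addNr expR0 scale1r.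
  by rewrite addrC subrK.
(* An algebraic identity valid for every [l], hence usable in both directions of the equivalence. *)
have ELE l : (expR (gamma t) * expR (alpha t)) *: (z t - grad h (X t)) +
    expR (gamma t) *: (l - 'D_(ddt T X t) (grad h) (X t))
    - dL_dposition L (X t) (ddt T X t) t
  = expR (gamma t) *: (l + expR (alpha t + beta t) *: grad Phi (X t)).
  rewrite dL_dpositionE// -/(z t) !expRD expRN; apply/rowP => i; rewrite !mxE.
  by field; rewrite gt_eqF ?expR_gt0.
rewrite /euler_lagrange pE /mirror_dynamics -/z; split=> -[].
- move=> dp; have [|l zl] := z' (ddt T p t); first exact/(has_ddtP Tlim).
  have /(has_ddtP Tlim)[_ ->] := p' _ zl.
  rewrite ELE => /eqP; rewrite scaler_eq0 (negPf (lt0r_neq0 (expR_gt0 _))) orFb.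
  rewrite addr_eq0 => /eqP lE.
  by rewrite -lE; apply/(has_ddtP Tlim).
- move=> dz zE; have zz : has_ddt T t z (ddt T z t) by apply/(has_ddtP Tlim).
  have /(has_ddtP Tlim)[dp ->] := p' _ zz.
  by split=> //; rewrite ELE zE addNr scaler0.
Qed.
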